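(* Let $X$ be a compact Hausdorff space. If the multiplication map $\mu_{OS}X:OS(OS(X))\to OS(X)$ of the monad $\mathbb{OS}$ is soft, then $X$ is metrizable.
   Context: For a compactum $X$, $OS(X)$ is the subspace of $\prod_{\varphi\in C(X)}[\min\varphi,\max\varphi]$ (product topology) consisting of functionals $\nu:C(X)\to\mathbb{R}$ that are normed ($\nu(1_X)=1$), weakly additive ($\nu(\varphi+c_X)=\nu(\varphi)+c$ for constants $c$), order-preserving ($\varphi\le\psi\Rightarrow\nu(\varphi)\le\nu(\psi)$), positively homogeneous ($\nu(t\varphi)=t\nu(\varphi)$, $t\ge0$) and semiadditive ($\nu(\varphi+\psi)\le\nu(\varphi)+\nu(\psi)$); for $f:X\to Y$, $OS(f)(\nu)(\varphi)=\nu(\varphi\circ f)$. The multiplication $\mu_{OS}X:OS(OS(X))\to OS(X)$ is $\mu_{OS}X(\nu)(\varphi)=\nu(\pi_\varphi)$, where $\pi_\varphi:OS(X)\to\mathbb{R}$, $\pi_\varphi(\lambda)=\lambda(\varphi)$. A map $f:X\to Y$ of compacta is soft if for every compactum $Z$, closed $A\subset Z$, and maps $\psi:A\to X$, $\Psi:Z\to Y$ with $\Psi|_A=f\circ\psi$, there is a map $G:Z\to X$ with $G|_A=\psi$ and $f\circ G=\Psi$. *)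

(* Defs.v *)
From Stdlib Require Import Reals Lra List Classical.
Open Scope R_scope.

Record TopSpace := {
  carrier :> Type;
  is_open : (carrier -> Prop) -> Prop;
  open_full : is_open (fun _ => True);
  open_inter : forall U V, is_open U -> is_open V -> is_open (fun x => U x /\ V x);
  open_union : forall F : (carrier -> Prop) -> Prop,
      (forall U, F U -> is_open U) -> is_open (fun x => exists U, F U /\ U x)
}.
Arguments is_open {_} _.

Definition is_closed {X : TopSpace} (A : X -> Prop) : Prop := is_open (fun x => ~ A x).

Definition continuous {X Y : TopSpace} (f : X -> Y) : Prop :=
  forall V : Y -> Prop, is_open V -> is_open (fun x => V (f x)).

Definition compact (X : TopSpace) : Prop :=
  forall F : (X -> Prop) -> Prop,
    (forall U, F U -> is_open U) -> (forall x, exists U, F U /\ U x) ->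
    exists l : list (X -> Prop), (forall U, In U l -> F U) /\
                                 (forall x, exists U, In U l /\ U x).

Definition hausdorff (X : TopSpace) : Prop :=
  forall x y : X, x <> y -> exists U V : X -> Prop,
    is_open U /\ is_open V /\ U x /\ V y /\ (forall z, ~ (U z /\ V z)).

Definition compactum (X : TopSpace) : Prop := compact X /\ hausdorff X.

Definition metrizable (X : TopSpace) : Prop :=
  exists d : X -> X -> R,
    (forall x y, d x y = 0 <-> x = y) /\
    (forall x y, d x y = d y x) /\
    (forall x y z, d x z <= d x y + d y z) /\
    (forall U : X -> Prop,
        is_open U <-> (forall x, U x -> exists e, 0 < e /\ forall y, d x y < e -> U y)).

Definition R_open (U : R -> Prop) : Prop :=
  forall x, U x -> exists e, 0 < e /\ forall y, Rabs (y - x) < e -> U y.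

Lemma R_open_full : R_open (fun _ => True).
Proof. intros x _; exists 1; split; [lra | auto]. Qed.

Lemma R_open_inter : forall U V, R_open U -> R_open V -> R_open (fun x => U x /\ V x).
Proof.
  intros U V HU HV x [Ux Vx].
  destruct (HU x Ux) as [e1 [He1 H1]]; destruct (HV x Vx) as [e2 [He2 H2]].
  exists (Rmin e1 e2); split; [apply Rmin_glb_lt; lra|].
  intros y Hy; split; [apply H1 | apply H2];
    eapply Rlt_le_trans; eauto; [apply Rmin_l | apply Rmin_r].
Qed.

Lemma R_open_union : forall F : (R -> Prop) -> Prop,
    (forall U, F U -> R_open U) -> R_open (fun x => exists U, F U /\ U x).
Proof.
  intros F HF x [U [FU Ux]].
  destruct (HF U FU x Ux) as [e [He H]].
  exists e; split; auto. intros y Hy; exists U; auto.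
Qed.

Definition R_top : TopSpace :=
  {| carrier := R; is_open := R_open; open_full := R_open_full;
     open_inter := R_open_inter; open_union := R_open_union |}.

Section Subspace.
Variables (Z : TopSpace) (A : Z -> Prop).

Definition sub_open (W : {z : Z | A z} -> Prop) : Prop :=
  exists U : Z -> Prop, is_open U /\ forall a, W a <-> U (proj1_sig a).

Lemma sub_open_full : sub_open (fun _ => True).
Proof. exists (fun _ => True); split; [apply open_full | tauto]. Qed.

Lemma sub_open_inter : forall U V, sub_open U -> sub_open V -> sub_open (fun x => U x /\ V x).
Proof.
  intros U V [U' [HU EU]] [V' [HV EV]].
  exists (fun z => U' z /\ V' z); split; [apply open_inter; auto|].
  intro a; rewrite EU, EV; tauto.
Qed.

Lemma sub_open_union : forall F : ({z : Z | A z} -> Prop) -> Prop,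
    (forall U, F U -> sub_open U) -> sub_open (fun x => exists U, F U /\ U x).
Proof.
  intros F HF.
  exists (fun z => exists U, (is_open U /\ exists W, F W /\ forall a, W a <-> U (proj1_sig a)) /\ U z).
  split.
  - apply open_union. intros U [HU _]; exact HU.
  - intro a; split.
    + intros [W [FW Wa]]. destruct (HF W FW) as [U [HU EU]].
      exists U; split; [split; [auto | exists W; auto] | apply EU; auto].
    + intros [U [[HU [W [FW EW]]] Ua]]. exists W; split; auto. apply EW; auto.
Qed.

Definition subspace : TopSpace :=
  {| carrier := {z : Z | A z}; is_open := sub_open; open_full := sub_open_full;
     open_inter := sub_open_inter; open_union := sub_open_union |}.
End Subspace.

Definition soft {X Y : TopSpace} (f : X -> Y) : Prop :=
  forall (Z : TopSpace), compactum Z ->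
  forall (A : Z -> Prop), is_closed A ->
  forall (psi : subspace Z A -> X) (Psi : Z -> Y),
    continuous psi -> continuous Psi ->
    (forall a : subspace Z A, Psi (proj1_sig a) = f (psi a)) ->
    exists G : Z -> X, continuous G /\
      (forall a : subspace Z A, G (proj1_sig a) = psi a) /\
      (forall z, f (G z) = Psi z).

Definition Cfun (X : TopSpace) : Type := {f : X -> R_top | continuous f}.

Definition cval {X : TopSpace} (phi : Cfun X) : X -> R := proj1_sig phi.

(** The defining conditions of OS(X).  Sums, constants and scalar
    multiples of elements of C(X) are written pointwise.  The last clause
    is membership in the product of the intervals [min phi, max phi]
    (phrased via inf/sup, which are the min/max for compact X). *)
Definition is_OS (X : TopSpace) (nu : Cfun X -> R) : Prop :=
  (forall phi : Cfun X, (forall x, cval phi x = 1) -> nu phi = 1) /\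
  (forall (phi psi : Cfun X) (c : R),
      (forall x, cval psi x = cval phi x + c) -> nu psi = nu phi + c) /\
  (forall phi psi : Cfun X, (forall x, cval phi x <= cval psi x) -> nu phi <= nu psi) /\
  (forall (phi psi : Cfun X) (t : R), 0 <= t ->
      (forall x, cval psi x = t * cval phi x) -> nu psi = t * nu phi) /\
  (forall phi psi chi : Cfun X,
      (forall x, cval chi x = cval phi x + cval psi x) -> nu chi <= nu phi + nu psi) /\
  (forall phi : Cfun X,
      (forall m, (forall x, m <= cval phi x) -> m <= nu phi) /\
      (forall M, (forall x, cval phi x <= M) -> nu phi <= M)).

Definition OS_car (X : TopSpace) : Type := {nu : Cfun X -> R | is_OS X nu}.

(** Product (pointwise convergence) topology, via basic neighbourhoods
    { nu' | |nu'(phi_i) - nu(phi_i)| < e_i, i = 1..n }. *)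
Definition OS_open (X : TopSpace) (U : OS_car X -> Prop) : Prop :=
  forall nu, U nu -> exists l : list (Cfun X * R),
      (forall p, In p l -> 0 < snd p) /\
      forall nu' : OS_car X,
        (forall p, In p l -> Rabs (proj1_sig nu' (fst p) - proj1_sig nu (fst p)) < snd p) ->
        U nu'.

Lemma OS_open_full X : OS_open X (fun _ => True).
Proof. intros nu _; exists nil; split; [intros p [] | auto]. Qed.

Lemma OS_open_inter X : forall U V, OS_open X U -> OS_open X V ->
  OS_open X (fun x => U x /\ V x).
Proof.
  intros U V HU HV nu [Un Vn].
  destruct (HU nu Un) as [l1 [P1 H1]]; destruct (HV nu Vn) as [l2 [P2 H2]].
  exists (l1 ++ l2); split.
  - intros p Hp; apply in_app_or in Hp; destruct Hp; auto.
  - intros nu' H; split; [apply H1 | apply H2]; intros p Hp; apply H, in_or_app; auto.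
Qed.

Lemma OS_open_union X : forall F : (OS_car X -> Prop) -> Prop,
    (forall U, F U -> OS_open X U) -> OS_open X (fun x => exists U, F U /\ U x).
Proof.
  intros F HF nu [U [FU Un]].
  destruct (HF U FU nu Un) as [l [P H]].
  exists l; split; auto. intros nu' H'; exists U; auto.
Qed.

Definition OS (X : TopSpace) : TopSpace :=
  {| carrier := OS_car X; is_open := OS_open X; open_full := OS_open_full X;
     open_inter := OS_open_inter X; open_union := OS_open_union X |}.

Lemma pi_sum_continuous (X : TopSpace) (phi psi : Cfun X) :
  @continuous (OS X) R_top (fun l : OS X => proj1_sig l phi + proj1_sig l psi).
Proof.
  intros V HV nu Vn.
  destruct (HV _ Vn) as [e [He H]].
  exists ((phi, e/2) :: (psi, e/2) :: nil); split.
  - intros p [<-|[<-|[]]]; simpl; lra.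
  - intros nu' Hn. apply H.
    assert (A1 := Hn (phi, e/2) (or_introl eq_refl)).
    assert (A2 := Hn (psi, e/2) (or_intror (or_introl eq_refl))).
    simpl in A1, A2.
    apply Rabs_def2 in A1; apply Rabs_def2 in A2.
    apply Rabs_def1; lra.
Qed.

Lemma pi_continuous (X : TopSpace) (phi : Cfun X) :
  @continuous (OS X) R_top (fun l : OS X => proj1_sig l phi).
Proof.
  intros V HV nu Vn.
  destruct (HV _ Vn) as [e [He H]].
  exists ((phi, e) :: nil); split.
  - intros p [<-|[]]; simpl; lra.
  - intros nu' Hn. apply H. exact (Hn (phi, e) (or_introl eq_refl)).
Qed.

Definition pi (X : TopSpace) (phi : Cfun X) : Cfun (OS X) :=
  exist _ (fun l : OS X => proj1_sig l phi) (pi_continuous X phi).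

Definition pi_sum (X : TopSpace) (phi psi : Cfun X) : Cfun (OS X) :=
  exist _ (fun l : OS X => proj1_sig l phi + proj1_sig l psi) (pi_sum_continuous X phi psi).

Definition mu_fun (X : TopSpace) (nu : OS (OS X)) : Cfun X -> R :=
  fun phi => proj1_sig nu (pi X phi).

Lemma mu_is_OS (X : TopSpace) (nu : OS (OS X)) : is_OS X (mu_fun X nu).
Proof.
  destruct nu as [n [N1 [N2 [N3 [N4 [N5 N6]]]]]]; unfold mu_fun; simpl.
  repeat split.
  - intros phi H; apply N1; intros [l Hl]; unfold cval; simpl; apply (proj1 Hl); auto.
  - intros phi psi c H; apply N2; intros [l Hl]; unfold cval; simpl;
      apply (proj1 (proj2 Hl)); auto.
  - intros phi psi H; apply N3; intros [l Hl]; unfold cval; simpl;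
      apply (proj1 (proj2 (proj2 Hl))); auto.
  - intros phi psi t Ht H; apply N4; auto;
      intros [l Hl]; unfold cval; simpl; apply (proj1 (proj2 (proj2 (proj2 Hl)))); auto.
  - intros phi psi chi H.
    apply Rle_trans with (n (pi_sum X phi psi)).
    + apply N3; intros [l Hl]; unfold cval; simpl;
        apply (proj1 (proj2 (proj2 (proj2 (proj2 Hl))))); auto.
    + apply N5; intros l; reflexivity.
  - intros m Hm. apply (proj1 (N6 (pi X phi))).
    intros [l Hl]; unfold cval; simpl.
    apply (proj1 (proj2 (proj2 (proj2 (proj2 (proj2 Hl)))) phi)); auto.
  - intros M HM. apply (proj2 (N6 (pi X phi))).
    intros [l Hl]; unfold cval; simpl.
    apply (proj2 (proj2 (proj2 (proj2 (proj2 (proj2 Hl)))) phi)); auto.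
Qed.

Definition mu_OS (X : TopSpace) : OS (OS X) -> OS X :=
  fun nu => exist _ (mu_fun X nu) (mu_is_OS X nu).

(* Main.v *)
(** The multiplication is not even open once [X] has four distinct points, so
    softness forces [X] to be finite.  Think of an element of [OS X] as the
    support function of a closed convex set of probability measures.  On four
    points take two segments [A] and [B] with [(A + B)/2] a flat square; the
    functional [N0 = (ev_A + ev_B)/2] is mapped by the multiplication to the
    square.  The square is a limit of thin tetrahedra [C_e], whose vertices lie
    alternately above and below its plane.  Softness lifts the sequence [C_e] to
    a sequence [N_e -> N0].  However, if [f], [g] are the coordinates in the
    plane of the square and [h] is the height, evaluating [N_e] on the functions
    [-s t h + e (s f + t g)], [s, t = 1, -1], yields [N_e H <= 1] for
    [H(l) = max (l f + l (-f)) (l g + l (-g))], whereas [N0 H = 2]. *)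

From Stdlib Require Import Reals Lra Lia List Classical ClassicalEpsilon.
From Stdlib Require Import FunctionalExtensionality PropExtensionality ProofIrrelevance.
Require Import Defs.
Open Scope R_scope.

(** * Extensionality of predicates and open sets *)

Lemma pred_ext (T : Type) (P Q : T -> Prop) : (forall x, P x <-> Q x) -> P = Q.
Proof.
  intro H; apply functional_extensionality; intro x.
  apply propositional_extensionality; auto.
Qed.

Lemma open_nbhd (T : TopSpace) (U : T -> Prop) :
  (forall x, U x -> exists V, is_open V /\ V x /\ forall y, V y -> U y) -> is_open U.
Proof.
  intro H.
  rewrite (pred_ext T U (fun x => exists V, (is_open V /\ forall y, V y -> U y) /\ V x)).
  - apply open_union; tauto.
  - intro x; split.
    + intro Ux; destruct (H x Ux) as [V [HV [Vx VU]]]; exists V; auto.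
    + intros [V [[_ VU] Vx]]; auto.
Qed.

(** * Real-valued continuous functions *)

Definition continuous_at {T : TopSpace} (f : T -> R) (x : T) : Prop :=
  forall e, 0 < e ->
    exists U : T -> Prop, is_open U /\ U x /\ forall y, U y -> Rabs (f y - f x) < e.

Lemma continuous_of_at (T : TopSpace) (f : T -> R) :
  (forall x, continuous_at f x) -> @continuous T R_top f.
Proof.
  intros H V HV; apply open_nbhd; intros x Vx.
  destruct (HV _ Vx) as [e [He HeV]].
  destruct (H x e He) as [U [HU [Ux HUe]]].
  exists U; auto.
Qed.

Lemma Cfun_continuous_at (T : TopSpace) (f : Cfun T) (x : T) : continuous_at (cval f) x.
Proof.
  intros e He.
  exists (fun y => Rabs (cval f y - cval f x) < e); split; [|split].
  - apply (proj2_sig f (fun r => Rabs (r - cval f x) < e)).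
    intros r Hr; exists (e - Rabs (r - cval f x)); split; [lra|].
    intros s Hs.
    replace (s - cval f x) with ((s - r) + (r - cval f x)) by ring.
    pose proof (Rabs_triang (s - r) (r - cval f x)); lra.
  - replace (cval f x - cval f x) with 0 by ring; rewrite Rabs_R0; exact He.
  - auto.
Qed.

(** The maximum is nonexpansive for the sup norm on the plane. This serves both the continuity of
    maxima and the convergence of the tetrahedra. *)
Lemma Rabs_Rmax_sub (a b c d e : R) :
  Rabs (a - c) < e -> Rabs (b - d) < e -> Rabs (Rmax a b - Rmax c d) < e.
Proof.
  intros H1 H2; apply Rabs_def2 in H1; apply Rabs_def2 in H2.
  apply Rabs_def1; unfold Rmax; destruct (Rle_dec a b), (Rle_dec c d); lra.
Qed.

Lemma continuous_add (T : TopSpace) (f g : Cfun T) :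
  @continuous T R_top (fun x => cval f x + cval g x).
Proof.
  apply continuous_of_at; intros x e He.
  destruct (Cfun_continuous_at T f x (e / 2)) as [U [HU [Ux Uf]]]; [lra|].
  destruct (Cfun_continuous_at T g x (e / 2)) as [V [HV [Vx Vg]]]; [lra|].
  exists (fun y => U y /\ V y); split; [apply open_inter; auto | split; auto].
  intros y [Uy Vy]; specialize (Uf y Uy); specialize (Vg y Vy).
  apply Rabs_def2 in Uf; apply Rabs_def2 in Vg; apply Rabs_def1; lra.
Qed.

Lemma continuous_max (T : TopSpace) (f g : Cfun T) :
  @continuous T R_top (fun x => Rmax (cval f x) (cval g x)).
Proof.
  apply continuous_of_at; intros x e He.
  destruct (Cfun_continuous_at T f x e He) as [U [HU [Ux Uf]]].
  destruct (Cfun_continuous_at T g x e He) as [V [HV [Vx Vg]]].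
  exists (fun y => U y /\ V y); split; [apply open_inter; auto | split; auto].
  intros y [Uy Vy]; apply Rabs_Rmax_sub; auto.
Qed.

Lemma continuous_scale (T : TopSpace) (a : R) (f : Cfun T) :
  @continuous T R_top (fun x => a * cval f x).
Proof.
  apply continuous_of_at; intros x e He.
  pose proof (Rabs_pos a) as Ha.
  (* The summand 1 keeps the denominator positive when [a] is 0. *)
  destruct (Cfun_continuous_at T f x (e / (Rabs a + 1))) as [U [HU [Ux Uf]]].
  { apply Rdiv_lt_0_compat; lra. }
  exists U; split; [|split]; auto.
  intros y Uy; specialize (Uf y Uy).
  rewrite <- Rmult_minus_distr_l, Rabs_mult.
  apply (Rmult_lt_compat_r (Rabs a + 1)) in Uf; [|lra].
  replace (e / (Rabs a + 1) * (Rabs a + 1)) with e in Uf by (field; lra).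
  pose proof (Rabs_pos (cval f y - cval f x)); nra.
Qed.

Definition cadd {T : TopSpace} (f g : Cfun T) : Cfun T := exist _ _ (continuous_add T f g).
Definition cmax {T : TopSpace} (f g : Cfun T) : Cfun T := exist _ _ (continuous_max T f g).
Definition cscale {T : TopSpace} (a : R) (f : Cfun T) : Cfun T :=
  exist _ _ (continuous_scale T a f).

(** * Normality and Urysohn's lemma *)

Definition separated {T : TopSpace} (K L : T -> Prop) : Prop :=
  exists U V : T -> Prop, is_open U /\ is_open V /\ (forall x, K x -> U x) /\
    (forall x, L x -> V x) /\ forall x, ~ (U x /\ V x).

(** Cover the space by the complement of [L] and by the open sets that have a disjoint open partner
    around [K]. From a finite subcover, unite these sets and intersect their partners. *)
Lemma compact_separated (T : TopSpace) (K L : T -> Prop) :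
  compact T -> is_closed L -> (forall y, L y -> separated K (fun z => z = y)) ->
  separated K L.
Proof.
  intros HT HL Hsep.
  pose (F := fun V : T -> Prop => V = (fun x => ~ L x) \/
    (is_open V /\ exists U, is_open U /\ (forall x, K x -> U x) /\ forall x, ~ (U x /\ V x))).
  destruct (HT F) as [l [lF lcov]].
  - intros V [->|[HV _]]; auto.
  - intro y; destruct (classic (L y)) as [Ly|nLy].
    + destruct (Hsep y Ly) as [U [V [HU [HV [KU [yV UV]]]]]].
      exists V; split; [right; split; eauto | auto].
    + exists (fun x => ~ L x); split; [left; auto | auto].
  - assert (E : exists U V : T -> Prop, is_open U /\ is_open V /\ (forall x, K x -> U x) /\
      (forall x, ~ (U x /\ V x)) /\
      forall W, In W l -> W = (fun x => ~ L x) \/ forall x, W x -> V x).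
    { clear lcov; induction l as [|W l IH].
      (* The empty set is presented as the union of the empty family, so that [open_union] proves it
         open. *)
      - exists (fun _ => True), (fun x => exists U : T -> Prop, False /\ U x).
        split; [apply open_full|]. split; [apply open_union; tauto|].
        split; [auto|]. split; [intros x [_ [U [[] _]]] | intros W []].
      - destruct IH as [U [V [HU [HV [KU [UV lV]]]]]]; [intros; apply lF; right; auto|].
        destruct (lF W (or_introl eq_refl)) as [EW|[HW [U' [HU' [KU' UW]]]]].
        + exists U, V; repeat split; auto.
          intros W' [<-|HW']; auto.
        + exists (fun x => U x /\ U' x), (fun x => exists O, (O = V \/ O = W) /\ O x).
          split; [apply open_inter; auto|].
          split; [apply open_union; intros O [->| ->]; auto|].
          split; [auto|]. split.
          * intros x [[Ux U'x] [O [[->| ->] Ox]]]; [apply (UV x) | apply (UW x)]; auto.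
          * intros W' [<-|HW']; [right; eauto|].
            destruct (lV W' HW'); [left|right]; eauto. }
    destruct E as [U [V [HU [HV [KU [UV lV]]]]]].
    exists U, V; repeat split; auto.
    intros x Lx; destruct (lcov x) as [W [HW Wx]].
    destruct (lV W HW) as [->|WV]; [contradiction | auto].
Qed.

Lemma separated_sym (T : TopSpace) (K L : T -> Prop) : separated K L -> separated L K.
Proof.
  intros [U [V [HU [HV [KU [LV UV]]]]]]; exists V, U; repeat split; auto.
  intros x [? ?]; apply (UV x); auto.
Qed.

(** Compactness acts twice: it passes from single points of [L] to all of [L] and, with the sides
    exchanged, from single points of [K] to all of [K]. *)
Lemma compactum_normal (T : TopSpace) (K L : T -> Prop) :
  compactum T -> is_closed K -> is_closed L -> (forall x, ~ (K x /\ L x)) -> separated K L.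
Proof.
  intros [HT H2] HK HL KL.
  apply compact_separated; auto; intros y Ly.
  apply separated_sym, compact_separated; auto; intros x Kx.
  destruct (H2 y x) as [U [V [HU [HV [Uy [Vx UV]]]]]].
  { intros ->; apply (KL x); auto. }
  exists U, V; repeat split; auto; intros z ->; auto.
Qed.

Definition closure {T : TopSpace} (A : T -> Prop) (x : T) : Prop :=
  forall U : T -> Prop, is_open U -> U x -> exists y, U y /\ A y.

Lemma subset_closure (T : TopSpace) (A : T -> Prop) (x : T) : A x -> closure A x.
Proof. intros Ax U _ Ux; exists x; auto. Qed.

Lemma not_closure (T : TopSpace) (A : T -> Prop) (x : T) :
  ~ closure A x -> exists U : T -> Prop, is_open U /\ U x /\ forall y, U y -> ~ A y.
Proof.
  intro H; apply not_all_ex_not in H; destruct H as [U H].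
  apply imply_to_and in H; destruct H as [HU H].
  apply imply_to_and in H; destruct H as [Ux H].
  exists U; repeat split; auto; intros y Uy Ay; apply H; eauto.
Qed.

Lemma closure_closed (T : TopSpace) (A : T -> Prop) : is_closed (closure A).
Proof.
  apply open_nbhd; intros x Hx.
  destruct (not_closure T A x Hx) as [U [HU [Ux UA]]].
  exists U; repeat split; auto.
  intros y Uy Ay; destruct (Ay U HU Uy) as [z [Uz Az]]; apply (UA z); auto.
Qed.

(** Both sets are open so that an interpolated set can serve as either end of the next pair. *)
Definition well_inside {T : TopSpace} (A B : T -> Prop) : Prop :=
  is_open A /\ is_open B /\ forall x, closure A x -> B x.

Lemma closed_compl (T : TopSpace) (U : T -> Prop) : is_open U -> is_closed (fun x => ~ U x).
Proof.
  intro HU; unfold is_closed.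
  rewrite (pred_ext T (fun x => ~ ~ U x) U); auto.
  intro x; split; [apply NNPP | auto].
Qed.

Lemma closed_open_interpolation (T : TopSpace) (K B : T -> Prop) :
  compactum T -> is_closed K -> is_open B -> (forall x, K x -> B x) ->
  exists M : T -> Prop, (forall x, K x -> M x) /\ well_inside M B.
Proof.
  intros HT HK HB KB.
  destruct (compactum_normal T K (fun x => ~ B x) HT HK) as [U [V [HU [HV [KU [BV UV]]]]]].
  - apply closed_compl; auto.
  - intros x [Kx nBx]; auto.
  - exists U; split; auto; repeat split; auto.
    intros x Ux; apply NNPP; intro nBx.
    destruct (Ux V HV (BV x nBx)) as [y Hy]; apply (UV y); tauto.
Qed.

(** The hypotheses sit inside the specification, so the chosen set is a total function of [A] and
    [B] and the recursion on it carries no proofs. *)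
Lemma interpolant_sig (T : TopSpace) (A B : T -> Prop) :
  {M : T -> Prop | compactum T -> well_inside A B -> well_inside A M /\ well_inside M B}.
Proof.
  apply constructive_indefinite_description.
  destruct (classic (compactum T /\ well_inside A B)) as [[HT [HA [HB AB]]]|H].
  - destruct (closed_open_interpolation T (closure A) B) as [M [AM MB]];
      auto using closure_closed.
    exists M; intros _ _; split; auto.
    destruct MB as [HM _]; repeat split; auto.
  - exists A; tauto.
Qed.

Definition interpolant {T : TopSpace} (A B : T -> Prop) : T -> Prop :=
  proj1_sig (interpolant_sig T A B).

Lemma interpolantP (T : TopSpace) (A B : T -> Prop) :
  compactum T -> well_inside A B ->
  well_inside A (interpolant A B) /\ well_inside (interpolant A B) B.
Proof. exact (proj2_sig (interpolant_sig T A B)). Qed.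

(* The n-th approximation to a Urysohn function that vanishes on the closure of A
   and equals 1 outside B. *)
Fixpoint ustep {T : TopSpace} (n : nat) (A B : T -> Prop) (x : T) : R :=
  match n with
  | O => if excluded_middle_informative (B x) then 0 else 1
  | S m => (ustep m A (interpolant A B) x + ustep m (interpolant A B) B x) / 2
  end.

Section Ustep.
Variables (T : TopSpace) (HT : compactum T).

Lemma ustep_bounds n (A B : T -> Prop) x : 0 <= ustep n A B x <= 1.
Proof.
  revert A B; induction n as [|n IH]; intros A B; simpl.
  - destruct (excluded_middle_informative (B x)); lra.
  - pose proof (IH A (interpolant A B)); pose proof (IH (interpolant A B) B); lra.
Qed.

Lemma ustep_inside n (A B : T -> Prop) x :
  well_inside A B -> closure A x -> ustep n A B x = 0.
Proof.
  revert A B; induction n as [|n IH]; intros A B HAB Ax; simpl.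
  - destruct (excluded_middle_informative (B x)) as [|nB]; auto.
    destruct nB; apply HAB; auto.
  - destruct (interpolantP T A B HT HAB) as [HAM HMB].
    rewrite !IH; auto; [lra|].
    apply subset_closure, HAM; auto.
Qed.

Lemma ustep_outside n (A B : T -> Prop) x :
  well_inside A B -> ~ B x -> ustep n A B x = 1.
Proof.
  revert A B; induction n as [|n IH]; intros A B HAB Bx; simpl.
  - destruct (excluded_middle_informative (B x)); tauto.
  - destruct (interpolantP T A B HT HAB) as [HAM HMB].
    rewrite !IH; auto; [lra|].
    intro Mx; apply Bx, HMB, subset_closure; auto.
Qed.

(** At every point one half of the average is settled at all levels: inside the interpolant the
    outer half is 0, outside it the inner half is 1. Only the other half moves, so the bound halves
    with each level. *)
Lemma ustep_increment n (A B : T -> Prop) x :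
  well_inside A B -> ustep n A B x <= ustep (S n) A B x <= ustep n A B x + (/ 2) ^ S n.
Proof.
  revert A B; induction n as [|n IH]; intros A B HAB;
    destruct (interpolantP T A B HT HAB) as [HAM HMB].
  - simpl; destruct (excluded_middle_informative (B x)) as [|nB],
      (excluded_middle_informative (interpolant A B x)) as [HM|]; try lra.
    destruct nB; apply HMB, subset_closure; auto.
  - change (ustep (S (S n)) A B x) with
      ((ustep (S n) A (interpolant A B) x + ustep (S n) (interpolant A B) B x) / 2).
    change (ustep (S n) A B x) with
      ((ustep n A (interpolant A B) x + ustep n (interpolant A B) B x) / 2).
    change ((/ 2) ^ S (S n)) with (/ 2 * (/ 2) ^ S n).
    pose proof (IH _ _ HAM) as I1; pose proof (IH _ _ HMB) as I2.
    destruct (classic (interpolant A B x)) as [Mx|nMx].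
    + rewrite !(ustep_inside _ (interpolant A B) B x); auto using subset_closure; lra.
    + rewrite !(ustep_outside _ A (interpolant A B) x); auto; lra.
Qed.

(** The approximants are step functions. In place of continuity their oscillation near each point is
    controlled, and it tends to 0. *)
Lemma ustep_oscillation n (A B : T -> Prop) x :
  well_inside A B ->
  exists U : T -> Prop, is_open U /\ U x /\
    forall y, U y -> Rabs (ustep n A B y - ustep n A B x) <= (/ 2) ^ n.
Proof.
  revert A B; induction n as [|n IH]; intros A B HAB.
  - exists (fun _ => True); split; [apply open_full | split; auto]; intros y _.
    pose proof (ustep_bounds 0 A B y); pose proof (ustep_bounds 0 A B x).
    simpl pow; apply Rabs_le; lra.
  - destruct (interpolantP T A B HT HAB) as [HAM HMB].
    simpl ustep; simpl pow; set (M := interpolant A B) in *.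
    destruct (IH A M HAM) as [U [HU [Ux UI]]].
    destruct (IH M B HMB) as [V [HV [Vx VI]]].
    assert (bnd : forall u v : R, Rabs u <= (/ 2) ^ n -> u = v * 2 -> Rabs v <= / 2 * (/ 2) ^ n).
    { intros u v Hu ->; rewrite Rabs_mult, (Rabs_pos_eq 2) in Hu by lra; lra. }
    destruct (classic (M x)) as [Mx|nMx]; [|destruct (classic (closure M x)) as [cMx|ncMx]].
    + exists (fun y => U y /\ M y); split; [apply open_inter; auto; apply HAM | split; auto].
      intros y [Uy My]; apply bnd with (1 := UI y Uy).
      rewrite !(ustep_inside _ M B); auto using subset_closure; lra.
    (* On the boundary of [M] both halves may vary, but the inner one can only drop from 1 and the
       outer one can only rise from 0. The changes have opposite signs, so half their sum is at most
       half the larger. *)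
    + exists (fun y => U y /\ V y); split; [apply open_inter; auto | split; auto].
      intros y [Uy Vy]; specialize (UI y Uy); specialize (VI y Vy).
      rewrite (ustep_outside n A M x), (ustep_inside n M B x) in * by auto.
      pose proof (ustep_bounds n A M y); pose proof (ustep_bounds n M B y).
      rewrite Rabs_left1 in UI by lra; rewrite Rabs_pos_eq in VI by lra.
      apply Rabs_le; lra.
    + destruct (not_closure T M x ncMx) as [W [HW [Wx WM]]].
      exists (fun y => V y /\ W y); split; [apply open_inter; auto | split; auto].
      intros y [Vy Wy]; apply bnd with (1 := VI y Vy).
      rewrite !(ustep_outside _ A M); auto; lra.
Qed.

Lemma ustep_mono n k (A B : T -> Prop) x :
  well_inside A B -> ustep n A B x <= ustep (n + k) A B x.
Proof.
  intro HAB; induction k as [|k IH]; [rewrite Nat.add_0_r; lra|].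
  rewrite Nat.add_succ_r; pose proof (ustep_increment (n + k) A B x HAB); lra.
Qed.

(** Each increment is at most half the current error term, so the upper ends decrease while the
    lower ends increase: the intervals are nested. *)
Lemma ustep_upper n k (A B : T -> Prop) x :
  well_inside A B -> ustep (n + k) A B x + (/ 2) ^ (n + k) <= ustep n A B x + (/ 2) ^ n.
Proof.
  intro HAB; induction k as [|k IH]; [rewrite Nat.add_0_r; lra|].
  rewrite Nat.add_succ_r; pose proof (ustep_increment (n + k) A B x HAB) as I.
  simpl pow in *; lra.
Qed.

Lemma ustep_le n m (A B : T -> Prop) x :
  well_inside A B -> ustep m A B x <= ustep n A B x + (/ 2) ^ n.
Proof.
  intro HAB.
  assert (P : forall i, 0 < (/ 2) ^ i) by (intro; apply pow_lt; lra).
  destruct (Nat.le_ge_cases m n) as [H|H].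
  - replace n with (m + (n - m))%nat by lia.
    pose proof (ustep_mono m (n - m) A B x HAB); specialize (P (m + (n - m))%nat); lra.
  - replace m with (n + (m - n))%nat by lia.
    pose proof (ustep_upper n (m - n) A B x HAB); specialize (P (n + (m - n))%nat); lra.
Qed.

(** The function is the pointwise supremum of the approximants. Uniform error and local oscillation
    are both at most [(/ 2) ^ n], whence continuity. *)
Lemma urysohn_open (A B : T -> Prop) :
  well_inside A B ->
  exists f : Cfun T, (forall x, A x -> cval f x = 0) /\ (forall x, ~ B x -> cval f x = 1).
Proof.
  intro HAB.
  assert (L : forall x, {l | is_lub (fun r => exists n, r = ustep n A B x) l}).
  { intro x; apply completeness.
    - exists 1; intros r [n ->]; apply ustep_bounds.
    - exists (ustep 0 A B x); eauto. }
  pose (f := fun x => proj1_sig (L x)).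
  assert (fn : forall n x, ustep n A B x <= f x <= ustep n A B x + (/ 2) ^ n).
  { intros n x; unfold f; destruct (L x) as [l [Hub Hlub]]; simpl; split.
    - apply Hub; eauto.
    - apply Hlub; intros r [m ->]; apply ustep_le; auto. }
  assert (Hlim : forall e, 0 < e -> exists n, (/ 2) ^ n < e).
  { intros e He; destruct (pow_lt_1_zero (/ 2)) with (y := e) as [n Hn]; auto.
    - rewrite Rabs_pos_eq; lra.
    - exists n; specialize (Hn n (le_n n)).
      rewrite Rabs_pos_eq in Hn; auto; apply pow_le; lra. }
  assert (Hc : @continuous T R_top f).
  { apply continuous_of_at; intros x e He.
    destruct (Hlim (e / 2)) as [n Hn]; [lra|].
    destruct (ustep_oscillation n A B x HAB) as [U [HU [Ux UI]]].
    exists U; repeat split; auto; intros y Uy; specialize (UI y Uy).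
    pose proof (fn n x); pose proof (fn n y).
    pose proof (Rle_abs (ustep n A B y - ustep n A B x)).
    pose proof (Rle_abs (- (ustep n A B y - ustep n A B x))) as Hm; rewrite Rabs_Ropp in Hm.
    apply Rabs_def1; lra. }
  assert (lim : forall c x, (forall n, ustep n A B x = c) -> f x = c).
  { intros c x Hx; apply Rle_antisym.
    - apply le_epsilon; intros e He; destruct (Hlim e He) as [n Hn].
      pose proof (fn n x); rewrite Hx in *; lra.
    - rewrite <- (Hx 0%nat); apply fn. }
  exists (exist _ f Hc); split; intros x Hx; apply lim; intro n.
  - apply ustep_inside; auto using subset_closure.
  - apply ustep_outside; auto.
Qed.

End Ustep.

Theorem urysohn (T : TopSpace) (K L : T -> Prop) :
  compactum T -> is_closed K -> is_closed L -> (forall x, ~ (K x /\ L x)) ->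
  exists f : Cfun T, (forall x, K x -> cval f x = 0) /\ (forall x, L x -> cval f x = 1).
Proof.
  intros HT HK HL KL.
  destruct (closed_open_interpolation T K (fun x => ~ L x)) as [M [KM HM]]; auto.
  { intros x Kx Lx; apply (KL x); auto. }
  destruct (urysohn_open T HT M _ HM) as [f [f0 f1]].
  exists f; split; auto.
Qed.

Lemma closed_pair (T : TopSpace) (a b : T) :
  hausdorff T -> is_closed (fun x => x = a \/ x = b).
Proof.
  intro H2; apply open_nbhd; intros x Hx.
  destruct (H2 x a) as [U [V [HU [_ [Ux [Va UV]]]]]]; [tauto|].
  destruct (H2 x b) as [U' [V' [HU' [_ [Ux' [Vb UV']]]]]]; [tauto|].
  exists (fun y => U y /\ U' y); split; [apply open_inter; auto | split; auto].
  intros y [Uy U'y] [->| ->]; [apply (UV a) | apply (UV' b)]; auto.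
Qed.

(** The difference of two Urysohn functions with exchanged roles takes the values 1 and -1, with no
    constant function to be built. *)
Lemma exists_sign_function (T : TopSpace) (a b c d : T) :
  compactum T -> a <> c -> a <> d -> b <> c -> b <> d ->
  exists f : Cfun T, cval f a = 1 /\ cval f b = 1 /\ cval f c = -1 /\ cval f d = -1.
Proof.
  intros HT Hac Had Hbc Hbd.
  destruct (urysohn T (fun x => x = a \/ x = b) (fun x => x = c \/ x = d)) as [f [f0 f1]];
    auto; try (apply closed_pair; apply HT).
  { intros x [[->| ->] [E|E]]; auto. }
  destruct (urysohn T (fun x => x = c \/ x = d) (fun x => x = a \/ x = b)) as [g [g0 g1]];
    auto; try (apply closed_pair; apply HT).
  { intros x [[->| ->] [E|E]]; auto. }
  assert (E : forall x, cval (cadd g (cscale (-1) f)) x = cval g x + -1 * cval f x)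
    by reflexivity.
  exists (cadd g (cscale (-1) f)); rewrite !E.
  rewrite (f0 a), (f0 b), (f1 c), (f1 d), (g1 a), (g1 b), (g0 c), (g0 d) by auto.
  repeat split; lra.
Qed.

(** * Finite Hausdorff spaces *)

Lemma finite_hausdorff_discrete (T : TopSpace) (l : list T) (U : T -> Prop) :
  hausdorff T -> (forall x, In x l) -> is_open U.
Proof.
  intros H2 Hl; apply open_nbhd; intros x Ux.
  assert (E : exists V, is_open V /\ V x /\ forall y, In y l -> V y -> y = x).
  { clear Hl; induction l as [|a l [V [HV [Vx HVl]]]].
    - exists (fun _ => True); split; [apply open_full | split; auto]; intros y [].
    - destruct (classic (a = x)) as [->|Hax].
      + exists V; repeat split; auto; intros y [<-|Hy]; auto.
      + destruct (H2 x a) as [W [W' [HW [_ [Wx [W'a WW']]]]]]; [auto|].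
        exists (fun y => V y /\ W y); split; [apply open_inter; auto | split; auto].
        intros y [<-|Hy] [Vy Wy]; auto.
        destruct (WW' a); auto. }
  destruct E as [V [HV [Vx HVx]]].
  exists V; repeat split; auto; intros y Vy; rewrite (HVx y); auto.
Qed.

Lemma discrete_metrizable (T : TopSpace) :
  (forall U : T -> Prop, is_open U) -> metrizable T.
Proof.
  intro HT.
  exists (fun x y => if excluded_middle_informative (x = y) then 0 else 1).
  split; [|split; [|split]].
  - intros x y; destruct (excluded_middle_informative (x = y)); split; intro; auto; try lra.
    contradiction.
  - intros x y; destruct (excluded_middle_informative (x = y)),
      (excluded_middle_informative (y = x)); auto; congruence.
  - intros x y z; destruct (excluded_middle_informative (x = y)),
      (excluded_middle_informative (y = z)), (excluded_middle_informative (x = z));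
      try lra; congruence.
  - intro U; split; [|auto].
    intros _ x Ux; exists 1; split; [lra|].
    intros y; destruct (excluded_middle_informative (x = y)) as [->|]; auto; lra.
Qed.

Lemma finite_or_four_points (T : Type) :
  (exists l : list T, forall x, In x l) \/
  exists a b c d : T, a <> b /\ a <> c /\ a <> d /\ b <> c /\ b <> d /\ c <> d.
Proof.
  assert (H : forall l : list T, (forall x, In x l) \/ exists x, ~ In x l).
  { intro l; destruct (classic (forall x, In x l)); auto using not_all_ex_not. }
  destruct (H nil) as [|[a _]]; [eauto|].
  destruct (H (a :: nil)) as [|[b Hb]]; [eauto|].
  destruct (H (a :: b :: nil)) as [|[c Hc]]; [eauto|].
  destruct (H (a :: b :: c :: nil)) as [|[d Hd]]; [eauto|].
  simpl in *; right; exists a, b, c, d; repeat split; intros E; subst; tauto.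
Qed.

(** * The convergent sequence as a compactum *)

(** The one-point compactification of the discrete naturals, with [None] at infinity. *)
Definition seq_open (U : option nat -> Prop) : Prop :=
  U None -> exists N, forall n, (N <= n)%nat -> U (Some n).

Lemma seq_open_full : seq_open (fun _ => True).
Proof. exists 0%nat; auto. Qed.

Lemma seq_open_inter U V : seq_open U -> seq_open V -> seq_open (fun x => U x /\ V x).
Proof.
  intros HU HV [Un Vn]; destruct (HU Un) as [N HN], (HV Vn) as [M HM].
  exists (N + M)%nat; intros n Hn; split; [apply HN | apply HM]; lia.
Qed.

Lemma seq_open_union (F : (option nat -> Prop) -> Prop) :
  (forall U, F U -> seq_open U) -> seq_open (fun x => exists U, F U /\ U x).
Proof.
  intros HF [U [FU Un]]; destruct (HF U FU Un) as [N HN].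
  exists N; intros n Hn; exists U; auto.
Qed.

Definition seq_top : TopSpace :=
  {| carrier := option nat; is_open := seq_open; open_full := seq_open_full;
     open_inter := seq_open_inter; open_union := seq_open_union |}.

Lemma seq_top_compactum : compactum seq_top.
Proof.
  split.
  - intros F HF Hcov.
    destruct (Hcov None) as [U [FU Un]]; destruct (HF U FU Un) as [N HN].
    (* One member around [None] covers a tail; the finitely many earlier terms are covered one by
       one. *)
    assert (E : forall M, exists l, (forall V, In V l -> F V) /\
      forall n, (n < M)%nat -> exists V, In V l /\ V (Some n)).
    { induction M as [|M [l [lF lM]]].
      - exists nil; split; [intros V [] | lia].
      - destruct (Hcov (Some M)) as [V [FV VM]].
        exists (V :: l); split.
        + intros W [<-|HW]; auto.
        + intros n Hn; destruct (Nat.eq_dec n M) as [->|Hne].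
          * exists V; split; [left|]; auto.
          * destruct (lM n) as [W [HW Wn]]; [lia | exists W; split; [right|]; auto]. }
    destruct (E N) as [l [lF lN]].
    exists (U :: l); split.
    + intros V [<-|HV]; auto.
    + intros [n|]; [|exists U; split; [left|]; auto].
      destruct (Nat.le_gt_cases N n) as [H|H].
      * exists U; split; [left|]; auto.
      * destruct (lN n H) as [V [HV Vn]]; exists V; split; [right|]; auto.
  - assert (O1 : forall n, seq_open (fun z => z = Some n)) by (intros n H; discriminate).
    assert (O2 : forall n, seq_open (fun z => z <> Some n)).
    { intros n _; exists (S n); intros m Hm H; injection H; lia. }
    intros x y Hxy; destruct x as [n|].
    + exists (fun z => z = Some n), (fun z => z <> Some n).
      split; [apply O1|]; split; [apply O2|]; split; [reflexivity|].
      split; [auto|]; intros z [? ?]; auto.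
    + destruct y as [n|]; [|congruence].
      exists (fun z => z <> Some n), (fun z => z = Some n).
      split; [apply O2|]; split; [apply O1|]; split; [discriminate|].
      split; [reflexivity|]; intros z [? ?]; auto.
Qed.

(** * Functionals *)

Lemma OS_eq (X : TopSpace) (nu nu' : OS_car X) :
  (forall phi, proj1_sig nu phi = proj1_sig nu' phi) -> nu = nu'.
Proof.
  destruct nu as [n Hn], nu' as [n' Hn']; simpl; intro H.
  assert (n = n') as -> by (apply functional_extensionality; auto).
  f_equal; apply proof_irrelevance.
Qed.

Fixpoint weights {T : Type} (l : list (R * T)) : R :=
  match l with nil => 0 | p :: l => fst p + weights l end.

(** The list stands for a finitely supported measure, repetitions allowed, and this is integration
    against it. It is used over [X] and over [OS X]. *)
Fixpoint wsum {X : TopSpace} (l : list (R * X)) (phi : Cfun X) : R :=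
  match l with nil => 0 | p :: l => fst p * cval phi (snd p) + wsum l phi end.

Definition convex_weights {T : Type} (l : list (R * T)) : Prop :=
  (forall p, In p l -> 0 <= fst p) /\ weights l = 1.

Section Wsum.
Variables (X : TopSpace) (l : list (R * X)).

Lemma wsum_affine (phi psi : Cfun X) (t c : R) :
  (forall x, cval psi x = t * cval phi x + c) -> wsum l psi = t * wsum l phi + c * weights l.
Proof. intro H; induction l as [|p l' IH]; simpl; [|rewrite IH, H]; ring. Qed.

Lemma wsum_add (phi psi chi : Cfun X) :
  (forall x, cval chi x = cval phi x + cval psi x) -> wsum l chi = wsum l phi + wsum l psi.
Proof. intro H; induction l as [|p l' IH]; simpl; [|rewrite IH, H]; ring. Qed.

Hypothesis Hl : forall p, In p l -> 0 <= fst p.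

Lemma wsum_le (phi psi : Cfun X) :
  (forall x, cval phi x <= cval psi x) -> wsum l phi <= wsum l psi.
Proof.
  intro H; induction l as [|p l' IH]; simpl; [lra|].
  assert (wsum l' phi <= wsum l' psi) by (apply IH; intros; apply Hl; right; auto).
  pose proof (Hl p (or_introl eq_refl)); pose proof (H (snd p)); nra.
Qed.

Lemma wsum_ge_const (phi : Cfun X) (m : R) :
  (forall x, m <= cval phi x) -> m * weights l <= wsum l phi.
Proof.
  intro H; induction l as [|p l' IH]; simpl; [lra|].
  assert (m * weights l' <= wsum l' phi) by (apply IH; intros; apply Hl; right; auto).
  pose proof (Hl p (or_introl eq_refl)); pose proof (H (snd p)); nra.
Qed.

Lemma wsum_le_const (phi : Cfun X) (M : R) :
  (forall x, cval phi x <= M) -> wsum l phi <= M * weights l.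
Proof.
  intro H; induction l as [|p l' IH]; simpl; [lra|].
  assert (wsum l' phi <= M * weights l') by (apply IH; intros; apply Hl; right; auto).
  pose proof (Hl p (or_introl eq_refl)); pose proof (H (snd p)); nra.
Qed.

End Wsum.

Lemma wsum_is_OS (X : TopSpace) (l : list (R * X)) : convex_weights l -> is_OS X (wsum l).
Proof.
  intros [Hl H1].
  split; [|split; [|split; [|split; [|split]]]].
  - intros phi H; rewrite (wsum_affine X l phi phi 0 1); [rewrite H1; ring|].
    intro x; rewrite H; ring.
  - intros phi psi c H; rewrite (wsum_affine X l phi psi 1 c); [rewrite H1; ring|].
    intro x; rewrite H; ring.
  - intros; apply wsum_le; auto.
  - intros phi psi t _ H; rewrite (wsum_affine X l phi psi t 0); [ring|].
    intro x; rewrite H; ring.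
  - intros phi psi chi H; rewrite (wsum_add X l phi psi chi H); lra.
  - intro phi; split; intros m H.
    + rewrite <- (Rmult_1_r m), <- H1; apply wsum_ge_const; auto.
    + rewrite <- (Rmult_1_r m), <- H1; apply wsum_le_const; auto.
Qed.

(** For support functions this is the convex hull of a union: sublinearity survives a maximum
    although additivity does not. *)
Lemma max_is_OS (X : TopSpace) (mu nu : Cfun X -> R) :
  is_OS X mu -> is_OS X nu -> is_OS X (fun phi => Rmax (mu phi) (nu phi)).
Proof.
  intros [A1 [A2 [A3 [A4 [A5 A6]]]]] [B1 [B2 [B3 [B4 [B5 B6]]]]].
  split; [|split; [|split; [|split; [|split]]]].
  - intros phi H; rewrite A1, B1; auto; apply Rmax_left; lra.
  - intros phi psi c H; rewrite (A2 phi psi c), (B2 phi psi c); auto.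
    unfold Rmax; destruct (Rle_dec (mu phi + c) (nu phi + c)), (Rle_dec (mu phi) (nu phi)); lra.
  - intros phi psi H; pose proof (A3 _ _ H); pose proof (B3 _ _ H).
    apply Rmax_lub; [apply Rle_trans with (2 := Rmax_l _ _)
                    | apply Rle_trans with (2 := Rmax_r _ _)]; auto.
  - intros phi psi t Ht H; rewrite (A4 phi psi t), (B4 phi psi t); auto.
    apply RmaxRmult; auto.
  - intros phi psi chi H; pose proof (A5 _ _ _ H); pose proof (B5 _ _ _ H).
    pose proof (Rmax_l (mu phi) (nu phi)); pose proof (Rmax_r (mu phi) (nu phi)).
    pose proof (Rmax_l (mu psi) (nu psi)); pose proof (Rmax_r (mu psi) (nu psi)).
    apply Rmax_lub; lra.
  - intro phi; split; intros m H.
    + apply Rle_trans with (2 := Rmax_l _ _); apply A6; auto.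
    + apply Rmax_lub; [apply A6 | apply B6]; auto.
Qed.

(** * Failure of openness over four points *)

Section FourPoints.
Variables (X : TopSpace) (a b c d : X).

(* The vertex of the tetrahedron with plane coordinates (s, t) and height e s t. *)
Definition vertex (e s t : R) : list (R * X) :=
  ((1 / 4 + (s + t + e * s * t) / 8, a) :: (1 / 4 + (s - t - e * s * t) / 8, b)
   :: (1 / 4 + (- s + t - e * s * t) / 8, c) :: (1 / 4 + (- s - t + e * s * t) / 8, d) :: nil).

(** The smallest weight is [e / 8], so at [e = 0] each vertex reaches the boundary of the
    simplex. *)
Lemma vertex_convex e s t :
  0 <= e <= 1 -> s = 1 \/ s = -1 -> t = 1 \/ t = -1 -> convex_weights (vertex e s t).
Proof.
  intros He [->| ->] [->| ->]; (split; [|simpl; lra]);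
    intros p [<-|[<-|[<-|[<-|[]]]]]; simpl; lra.
Qed.

Definition tetrahedron (e : R) (phi : Cfun X) : R :=
  Rmax (Rmax (wsum (vertex e 1 1) phi) (wsum (vertex e 1 (-1)) phi))
       (Rmax (wsum (vertex e (-1) 1) phi) (wsum (vertex e (-1) (-1)) phi)).

Lemma tetrahedron_is_OS e : 0 <= e <= 1 -> is_OS X (tetrahedron e).
Proof.
  intro He; repeat apply max_is_OS; apply wsum_is_OS, vertex_convex; auto.
Qed.

Definition segment (p q p' q' : X) (phi : Cfun X) : R :=
  Rmax (wsum ((1 / 2, p) :: (1 / 2, q) :: nil) phi) (wsum ((1 / 2, p') :: (1 / 2, q') :: nil) phi).

Lemma segment_is_OS p q p' q' : is_OS X (segment p q p' q').
Proof.
  apply max_is_OS; apply wsum_is_OS; (split; [|simpl; lra]);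
    intros r [<-|[<-|[]]]; simpl; lra.
Qed.

Definition OS_segment (p q p' q' : X) : OS X := exist _ _ (segment_is_OS p q p' q').

(** In the sign coordinates [f], [g], [h] fixed later, the first segment runs along the [f] axis and
    the second along the [g] axis. *)
Definition segment_pair : list (R * OS X) :=
  (1 / 2, OS_segment a b c d) :: (1 / 2, OS_segment a c b d) :: nil.

Lemma segment_pair_convex : convex_weights segment_pair.
Proof.
  split; [|simpl; lra]; intros r [<-|[<-|[]]]; simpl; lra.
Qed.

Definition N0 : OS (OS X) := exist _ _ (wsum_is_OS (OS X) _ segment_pair_convex).

(** Half the sum of two maxima is the maximum of the four half sums: the Minkowski average of two
    crossing segments is a square. *)
Lemma mu_N0 phi : mu_fun X N0 phi = tetrahedron 0 phi.
Proof.
  unfold mu_fun, tetrahedron, N0; simpl; unfold segment; simpl.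
  unfold Rmax; repeat destruct Rle_dec; lra.
Qed.

(** * Convergence of the tetrahedra to the square *)

Definition eps (z : option nat) : R :=
  match z with None => 0 | Some n => / INR (S n) end.

Lemma eps_bounds z : 0 <= eps z <= 1.
Proof.
  destruct z as [n|]; cbn [eps]; [|lra].
  assert (1 <= INR (S n)) by (rewrite S_INR; pose proof (pos_INR n); lra).
  split; [left; apply Rinv_0_lt_compat; lra|].
  rewrite <- Rinv_1; apply Rinv_le_contravar; lra.
Qed.

Lemma eps_eventually_small (e : R) :
  0 < e -> exists N, forall n, (N <= n)%nat -> eps (Some n) < e.
Proof.
  intro He; destruct (archimed_cor1 e He) as [N [HN HN0]].
  exists N; intros n Hn; cbn [eps].
  apply Rle_lt_trans with (2 := HN).
  apply Rinv_le_contravar; [apply lt_0_INR; auto | apply le_INR; lia].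
Qed.

Definition tetrahedra (z : seq_top) : OS X :=
  exist _ (tetrahedron (eps z)) (tetrahedron_is_OS (eps z) (eps_bounds z)).

(** Each vertex integral is affine in the height parameter [h] with slope at most [S], and maxima do
    not expand distances. *)
Lemma tetrahedron_limit (phi : Cfun X) (e : R) :
  0 < e -> exists r, 0 < r /\ forall h, 0 <= h < r ->
    Rabs (tetrahedron h phi - tetrahedron 0 phi) < e.
Proof.
  intro He.
  set (S := Rabs (cval phi a - cval phi b - cval phi c + cval phi d)).
  pose proof (Rabs_pos (cval phi a - cval phi b - cval phi c + cval phi d)) as HS.
  fold S in HS.
  exists (e / (S + 1)); split; [apply Rdiv_lt_0_compat; lra|].
  intros h [Hh0 Hh].
  assert (Hb : h * S < e).
  { apply (Rmult_lt_compat_r (S + 1)) in Hh; [|lra].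
    replace (e / (S + 1) * (S + 1)) with e in Hh by (field; lra); nra. }
  assert (V : forall s t, s = 1 \/ s = -1 -> t = 1 \/ t = -1 ->
    Rabs (wsum (vertex h s t) phi - wsum (vertex 0 s t) phi) < e).
  { intros s t Hs Ht.
    replace (wsum (vertex h s t) phi - wsum (vertex 0 s t) phi)
      with (h * (s * t / 8) * (cval phi a - cval phi b - cval phi c + cval phi d))
      by (simpl; field).
    rewrite !Rabs_mult; fold S; rewrite (Rabs_pos_eq h) by auto.
    assert (Rabs (s * t / 8) <= 1)
      by (apply Rabs_le; destruct Hs as [->| ->], Ht as [->| ->]; lra).
    pose proof (Rabs_pos (s * t / 8)).
    assert (0 <= h * S) by nra; nra. }
  unfold tetrahedron; repeat apply Rabs_Rmax_sub; apply V; auto.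
Qed.

(** Openness in [seq_top] is a condition at [None] only, and a basic neighbourhood in [OS X]
    involves finitely many test functions, so pointwise convergence suffices. *)
Lemma tetrahedra_continuous : @continuous seq_top (OS X) tetrahedra.
Proof.
  intros V HV V0; destruct (HV _ V0) as [l [Hl HlV]].
  assert (E : exists N, forall n, (N <= n)%nat -> forall p, In p l ->
    Rabs (tetrahedron (eps (Some n)) (fst p) - tetrahedron 0 (fst p)) < snd p).
  { clear HlV; induction l as [|p l IH].
    - exists 0%nat; intros n _ p [].
    - destruct IH as [N HN]; [intros; apply Hl; right; auto|].
      destruct (tetrahedron_limit (fst p) (snd p)) as [r [Hr Hrp]]; [apply Hl; left; auto|].
      destruct (eps_eventually_small r Hr) as [M HM].
      exists (N + M)%nat; intros n Hn q [<-|Hq].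
      + apply Hrp; split; [apply eps_bounds | apply HM; lia].
      + apply HN; auto; lia. }
  destruct E as [N HN]; exists N; intros n Hn.
  apply HlV; intros p Hp; apply HN; auto.
Qed.

(** This is [H]: [l k + l (-k)] is the width in direction [k] of the convex set that [l]
    represents. *)
Definition width_function (f g : Cfun X) : Cfun (OS X) :=
  cmax (cadd (pi X f) (pi X (cscale (-1) f))) (cadd (pi X g) (pi X (cscale (-1) g))).

(** In the sign coordinates, for [e > 0], these are outer normals to the four faces of the
    tetrahedron. *)
Definition tilted (e s t : R) (f g h : Cfun X) : Cfun X :=
  cadd (cscale (- (s * t)) h) (cscale e (cadd (cscale s f) (cscale t g))).

(* Subadditivity kills h when the four functionals are paired along equal s, or
   along equal t; pairing by s leaves the width of l in direction f, pairing by t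
   its width in direction g. *)
Lemma sum_tilted_ge_width (l : OS X) (e : R) (f g h : Cfun X) :
  0 <= e ->
  2 * e * cval (width_function f g) l <=
  proj1_sig l (tilted e 1 1 f g h) + proj1_sig l (tilted e 1 (-1) f g h) +
  (proj1_sig l (tilted e (-1) 1 f g h) + proj1_sig l (tilted e (-1) (-1) f g h)).
Proof.
  intro He; destruct (proj2_sig l) as [_ [_ [_ [L4 [L5 _]]]]].
  change (cval (width_function f g) l) with
    (Rmax (proj1_sig l f + proj1_sig l (cscale (-1) f))
          (proj1_sig l g + proj1_sig l (cscale (-1) g))).
  generalize (proj1_sig l), L4, L5; clear l L4 L5; intros l L4 L5.
  assert (P : forall (k : Cfun X) (phi psi : Cfun X),
    (forall x, cval phi x + cval psi x = 2 * e * cval k x) -> 2 * e * l k <= l phi + l psi).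
  { intros k phi psi H.
    rewrite <- (L4 k (cscale (2 * e) k)); [|lra|reflexivity].
    apply L5; intro x; rewrite H; reflexivity. }
  assert (F1 : 2 * e * l f <= l (tilted e 1 1 f g h) + l (tilted e 1 (-1) f g h)).
  { apply P; intro x; cbn; ring. }
  assert (F2 : 2 * e * l (cscale (-1) f) <=
    l (tilted e (-1) 1 f g h) + l (tilted e (-1) (-1) f g h)).
  { apply P; intro x; cbn; ring. }
  assert (G1 : 2 * e * l g <= l (tilted e 1 1 f g h) + l (tilted e (-1) 1 f g h)).
  { apply P; intro x; cbn; ring. }
  assert (G2 : 2 * e * l (cscale (-1) g) <=
    l (tilted e 1 (-1) f g h) + l (tilted e (-1) (-1) f g h)).
  { apply P; intro x; cbn; ring. }
  rewrite <- RmaxRmult by lra; apply Rmax_lub; lra.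
Qed.

(** Monotonicity, homogeneity and subadditivity of [N] carry over the preceding inequality:
    [2 e N(H)] is at most a sum of four values, each at most [e m]. *)
Lemma width_le_of_tilted (N : OS (OS X)) (e m : R) (f g h : Cfun X) :
  0 < e ->
  (forall s t, s = 1 \/ s = -1 -> t = 1 \/ t = -1 ->
     mu_fun X N (tilted e s t f g h) <= e * m) ->
  proj1_sig N (width_function f g) <= 2 * m.
Proof.
  intros He Hm.
  pose proof (Hm 1 1 (or_introl eq_refl) (or_introl eq_refl)) as M1.
  pose proof (Hm 1 (-1) (or_introl eq_refl) (or_intror eq_refl)) as M2.
  pose proof (Hm (-1) 1 (or_intror eq_refl) (or_introl eq_refl)) as M3.
  pose proof (Hm (-1) (-1) (or_intror eq_refl) (or_intror eq_refl)) as M4.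
  destruct (proj2_sig N) as [_ [_ [N3 [N4 [N5 _]]]]]; unfold mu_fun in *.
  set (p s t := pi X (tilted e s t f g h)) in *.
  fold (p 1 1) in M1; fold (p 1 (-1)) in M2; fold (p (-1) 1) in M3; fold (p (-1) (-1)) in M4.
  pose proof (N4 (width_function f g) (cscale (2 * e) (width_function f g)) (2 * e)
    ltac:(lra) (fun _ => eq_refl)) as E1.
  pose proof (N3 (cscale (2 * e) (width_function f g))
    (cadd (cadd (p 1 1) (p 1 (-1))) (cadd (p (-1) 1) (p (-1) (-1))))
    (fun l => sum_tilted_ge_width l e f g h (Rlt_le _ _ He))) as E2.
  assert (N5' : forall phi psi, proj1_sig N (cadd phi psi) <= proj1_sig N phi + proj1_sig N psi)
    by (intros; apply N5; reflexivity).
  pose proof (N5' (cadd (p 1 1) (p 1 (-1))) (cadd (p (-1) 1) (p (-1) (-1)))) as E3.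
  pose proof (N5' (p 1 1) (p 1 (-1))) as E4.
  pose proof (N5' (p (-1) 1) (p (-1) (-1))) as E5.
  apply Rmult_le_reg_l with (2 * e); [lra|].
  lra.
Qed.

(** * Coordinates adapted to the four points *)

Variables (f g h : Cfun X).
Hypothesis Hf : cval f a = 1 /\ cval f b = 1 /\ cval f c = -1 /\ cval f d = -1.
Hypothesis Hg : cval g a = 1 /\ cval g c = 1 /\ cval g b = -1 /\ cval g d = -1.
Hypothesis Hh : cval h a = 1 /\ cval h d = 1 /\ cval h b = -1 /\ cval h c = -1.

(** At the vertex with signs [s'], [t'] put [u = s s'] and [v = t t']. The value there is
    [(e / 2) (u + v - u v)], and [u + v - u v = 1 - (1 - u) (1 - v)] is 1 at three vertices and -3
    at the fourth. *)
Lemma tetrahedron_tilted e s t :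
  0 <= e -> s = 1 \/ s = -1 -> t = 1 \/ t = -1 ->
  tetrahedron e (tilted e s t f g h) <= e * (1 / 2).
Proof.
  intros He Hs Ht.
  assert (E : forall x, cval (tilted e s t f g h) x =
    - (s * t) * cval h x + e * (s * cval f x + t * cval g x)) by reflexivity.
  destruct Hf as [fa [fb [fc fd]]], Hg as [ga [gc [gb gd]]], Hh as [ha [hd [hb hc]]].
  unfold tetrahedron, vertex; cbn [wsum fst snd]; rewrite !E, fa, fb, fc, fd, ga, gb, gc, gd, ha, hb, hc, hd.
  destruct Hs as [->| ->], Ht as [->| ->]; repeat apply Rmax_lub; lra.
Qed.

(** Each segment has width 2 in its own direction and 0 in the other, so the larger width is 2 on
    both. *)
Lemma N0_width : proj1_sig N0 (width_function f g) = 2.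
Proof.
  assert (E : forall (k : Cfun X) x, cval (cscale (-1) k) x = - 1 * cval k x) by reflexivity.
  assert (W : forall l : OS X, cval (width_function f g) l =
    Rmax (proj1_sig l f + proj1_sig l (cscale (-1) f))
         (proj1_sig l g + proj1_sig l (cscale (-1) g))) by reflexivity.
  destruct Hf as [fa [fb [fc fd]]], Hg as [ga [gc [gb gd]]].
  unfold N0, segment_pair, OS_segment; cbn [proj1_sig wsum fst snd].
  rewrite !W; cbn [proj1_sig]; unfold segment; cbn [wsum fst snd].
  rewrite !E, fa, fb, fc, fd, ga, gb, gc, gd.
  unfold Rmax; repeat destruct Rle_dec; lra.
Qed.

Lemma mu_not_soft_of_coordinates : ~ soft (mu_OS X).
Proof.
  intro Hsoft.
  (* The lift is prescribed only at the limit point, where it is [N0]. *)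
  destruct (Hsoft seq_top seq_top_compactum (fun z => z = None)) with
    (psi := fun _ : subspace seq_top (fun z => z = None) => N0) (Psi := tetrahedra)
    as [G [HG [GA Gmu]]].
  - intro H; destruct H; reflexivity.
  - intros V HV.
    destruct (classic (V N0)) as [H|H].
    + exists (fun _ => True); split; [apply open_full | tauto].
    + exists (fun z : seq_top => exists U : seq_top -> Prop, False /\ U z).
      split; [apply (open_union seq_top (fun _ => False)); tauto | intro z; split].
      * tauto.
      * intros [U [[] _]].
  - exact tetrahedra_continuous.
  - intros [z Hz]; simpl; subst z; apply OS_eq; intro phi; symmetry; apply mu_N0.
  - specialize (GA (exist _ None eq_refl)); simpl in GA.
    (* The value on [H] is 2 at the limit, so continuity keeps it above 1 on a tail, against the
       bound 1 that holds off the limit. *)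
    destruct (HG (fun N => Rabs (proj1_sig N (width_function f g) - 2) < 1)) as [n Hn].
    + apply (pi_continuous (OS X) (width_function f g) (fun r => Rabs (r - 2) < 1)).
      intros r Hr; exists (1 - Rabs (r - 2)); split; [lra|].
      intros y Hy; replace (y - 2) with ((y - r) + (r - 2)) by ring.
      pose proof (Rabs_triang (y - r) (r - 2)); lra.
    + rewrite GA, N0_width; replace (2 - 2) with 0 by ring; rewrite Rabs_R0; lra.
    + specialize (Hn n (le_n n)); apply Rabs_def2 in Hn.
      assert (He : 0 < eps (Some n)) by (apply Rinv_0_lt_compat, lt_0_INR; lia).
      assert (proj1_sig (G (Some n)) (width_function f g) <= 2 * (1 / 2)); [|lra].
      apply width_le_of_tilted with (eps (Some n)) h; auto.
      intros s t Hs Ht.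
      change (proj1_sig (mu_OS X (G (Some n))) (tilted (eps (Some n)) s t f g h)
              <= eps (Some n) * (1 / 2)).
      rewrite Gmu; apply tetrahedron_tilted; auto; lra.
Qed.

End FourPoints.

(** * Softness forces finiteness *)

Lemma mu_not_soft (X : TopSpace) (a b c d : X) :
  compactum X -> a <> b -> a <> c -> a <> d -> b <> c -> b <> d -> c <> d ->
  ~ soft (mu_OS X).
Proof.
  intros HX ab ac ad bc bd cd.
  (* The three splittings of four points into two pairs give three orthogonal sign functions. *)
  destruct (exists_sign_function X a b c d) as [f Hf]; auto.
  destruct (exists_sign_function X a c b d) as [g Hg]; auto.
  destruct (exists_sign_function X a d b c) as [h Hh]; auto.
  exact (mu_not_soft_of_coordinates X a b c d f g h Hf Hg Hh).
Qed.

Theorem theorem2 (X : TopSpace) (HX : compactum X) :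
  soft (mu_OS X) -> metrizable X.
Proof.
  intro Hsoft.
  destruct (finite_or_four_points X) as [[l Hl]|[a [b [c [d [ab [ac [ad [bc [bd cd]]]]]]]]]].
  - apply discrete_metrizable; intro U.
    apply finite_hausdorff_discrete with l; [apply HX | exact Hl].
  - destruct (mu_not_soft X a b c d HX ab ac ad bc bd cd Hsoft).
Qed.
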